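(* For any partitions $\lambda,\mu$, the one-variable function $\mathbb{F}_{\lambda/\mu}(\kappa\mid\Xi,\mathsf{S})$ is given as follows. If $\mu\prec\lambda$, then $$\mathbb{F}_{\lambda/\mu}(\kappa\mid\Xi,\mathsf{S})=(-\kappa)^{|\lambda|-|\mu|}\prod_{i\ge1}\xi_{i-1}^{\mu_i-\lambda_i}\Bigl(\frac{s_i\xi_i}{s_{i-1}\xi_{i-1}}\Bigr)^{\mu_i/2}\frac{(\kappa^{-1}s_i\xi_i;q)_{\lambda_i-\mu_i}(\kappa s_i/\xi_i;q)_{\mu_i-\lambda_{i+1}}(q;q)_{\lambda_i-\lambda_{i+1}}}{(q;q)_{\lambda_i-\mu_i}(q;q)_{\mu_i-\lambda_{i+1}}(s_i^2;q)_{\lambda_i-\lambda_{i+1}}},$$ and $\mathbb{F}_{\lambda/\mu}(\kappa\mid\Xi,\mathsf{S})=0$ otherwise.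
   Context: Fix a generic parameter $q$, and write $(x;q)_n:=\prod_{i=1}^n(1-xq^{i-1})$, $(x;q)_0:=1$. A partition is a weakly decreasing sequence $\lambda=(\lambda_1\ge\lambda_2\ge\dots\ge0)$ of nonnegative integers with finitely many nonzero entries; $l(\lambda)$ is the number of nonzero parts, $|\lambda|=\sum_i\lambda_i$, and $\lambda'$ is the conjugate partition, so the number of parts of $\lambda'$ equal to $j$ is $m_j(\lambda')=\lambda_j-\lambda_{j+1}$. Write $\mu\prec\lambda$ (interlacing) if $\lambda_i\ge\mu_i\ge\lambda_{i+1}$ for all $i\ge1$. Let $\Xi=(\xi_0,\xi_1,\dots)$ and $\mathsf{S}=(s_0,s_1,\dots)$ be sequences of generic parameters, with fixed square roots $\sqrt{\xi_i},\sqrt{s_i}$; all square roots below are formed from these. Put $s_i^{(1)}:=\sqrt{s_{i+1}\xi_{i+1}s_i/\xi_i}$ and $\tau_{\Xi}\mathsf{S}:=(s^{(1)}_0,s^{(1)}_1,\dots)$. Vertex weights: for $i,j,k,l\in\mathbb{Z}_{\ge0}$ (labels of the bottom, left, top, right edge), $$W_{t,s}(i,j;k,l):=\mathbf{1}_{i+j=k+l}\,\mathbf{1}_{i\ge l}\,(s^2/t^2)^{l}\frac{(s^2/t^2;q)_{i-l}(t^2;q)_l}{(s^2;q)_i}\frac{(q;q)_i}{(q;q)_{i-l}(q;q)_l},$$ which depends only on $t^2,s^2$. For $a\in\mathbb{Z}_{\ge0}$ and $L>l(\lambda),l(\mu)$ set $$ZW^{(a)}_{\lambda/\mu}(\kappa\mid\Xi,\mathsf{S}):=\sum\prod_{c=1}^L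 W_{t_{c},\,s^{(1)}_c}(m_c(\mu'),h_{c-1};m_c(\lambda'),h_{c}),\qquad t_{c}^2=\frac{\xi_{c+1}s_{c+1}}{\kappa},$$ where the sum is over nonnegative integers $h_0,\dots,h_L$ with $h_0=a$, $h_L=0$; the result does not depend on $L$. Then $$\mathbb{F}_{\lambda/\mu}(\kappa\mid\Xi,\mathsf{S}):=\frac{(-\tau_\Xi\mathsf{S})^{\mu}}{(-\mathsf{S})^{\lambda}}\frac{\mathsf{c}_{\tau_\Xi\mathsf{S}}(\mu)}{\mathsf{c}_{\mathsf{S}}(\lambda)}\,(\kappa s_0/\xi_0)^{\lambda_1-\mu_1}\frac{(\kappa^{-1}s_1\xi_1;q)_{\lambda_1-\mu_1}}{(q;q)_{\lambda_1-\mu_1}}\,ZW^{(\lambda_1-\mu_1)}_{\lambda/\mu}(\kappa\mid\Xi,\mathsf{S})$$ if $\lambda_1\ge\mu_1$, and $\mathbb{F}_{\lambda/\mu}(\kappa\mid\Xi,\mathsf{S}):=0$ if $\lambda_1<\mu_1$. Here $\mathsf{c}_{\mathsf{S}}(\lambda):=\prod_{i\ge1}\frac{(s_i^2;q)_{\lambda_i-\lambda_{i+1}}}{(q;q)_{\lambda_i-\lambda_{i+1}}}$ and $(-\mathsf{S})^\lambda:=\prod_{i\ge1}(-s_{i-1})^{\lambda_i}$ (and likewise with $\mathsf S$ replaced by $\tau_\Xi\mathsf S$). *)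

(* Defs.v *)
From mathcomp Require Import all_boot all_order all_algebra.
From mathcomp Require Import classical_sets fsbigop.

Set Implicit Arguments.
Unset Strict Implicit.
Unset Printing Implicit Defensive.

Import Order.TTheory GRing.Theory Num.Theory.

Local Open Scope classical_set_scope.
Local Open Scope ring_scope.

(* A partition is stored as the list of its nonzero parts, so that [size la]
   is l(la) and [sumn la] is |la|. *)
Record intpart := IntPart {
  intpart_seq :> seq nat;
  intpartP : sorted geq intpart_seq && (0%N \notin intpart_seq)
}.

(* The i-th part, counted from 1 ([part la 0] is junk); it is 0 for i > l(la). *)
Definition part (la : seq nat) (i : nat) : nat := nth 0%N la i.-1.

(* la'_j = #{i | la_i >= j} for j = 1, ..., la_1 *)
Definition conjugate (la : seq nat) : seq nat :=
  [seq count (leq j) la | j <- iota 1 (part la 1%N)].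

Definition multiplicity (j : nat) (la : seq nat) : nat := count_mem j la.

Definition interlace (mu la : seq nat) : Prop :=
  forall i : nat, (0 < i)%N ->
    (part mu i <= part la i)%N /\ (part la i.+1 <= part mu i)%N.

(* Product over all i >= 1 of a family with finitely many factors different
   from 1.  For families with infinite support the library value is 1; all the
   products formed below are finitely supported. *)
Definition prod_ge1 (F : fieldType) (f : nat -> F) : F :=
  \big[*%R/1]_(i \in [set i : nat | (0 < i)%N]) f i.

Definition qpoch (F : fieldType) (q x : F) (n : nat) : F :=
  \prod_(1 <= i < n.+1) (1 - x * q ^+ i.-1).

(* The sequence (s_i^{(1)})_i, from the square roots rxi i of xi_i and rs i of
   s_i: s_i^{(1)} = sqrt (s_{i+1} xi_{i+1} s_i / xi_i). *)
Definition tau (F : fieldType) (rxi rs : nat -> F) (i : nat) : F :=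
  rs i.+1 * rxi i.+1 * rs i / rxi i.

(* The weight W_{t,s}(i,j;k,l), as a function of t2 = t^2 and s2 = s^2. *)
Definition W (F : fieldType) (q t2 s2 : F) (i j k l : nat) : F :=
  (i + j == k + l)%N%:R * (l <= i)%N%:R * (s2 / t2) ^+ l
  * (qpoch q (s2 / t2) (i - l) * qpoch q t2 l / qpoch q s2 i)
  * (qpoch q q i / (qpoch q q (i - l) * qpoch q q l)).

(* The sum over all h_0, ..., h_L >= 0 with h_0 = a and h_L = 0.  Conservation
   i + j = k + l leaves at most one nonzero term, so this finitely supported
   sum over an infinite index set is the intended one. *)
Definition ZW (F : fieldType) (q : F) (xi s rxi rs : nat -> F) (L a : nat)
    (la mu : seq nat) (kappa : F) : F :=
  \sum_(h \in [set h : {ffun 'I_L.+1 -> nat} | h ord0 = a /\ h ord_max = 0%N])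
    \prod_(1 <= c < L.+1)
      W q (xi c.+1 * s c.+1 / kappa) (tau rxi rs c ^+ 2)
        (multiplicity c (conjugate mu)) (h (inord c.-1))
        (multiplicity c (conjugate la)) (h (inord c)).

(* c_S(la) *)
Definition cS (F : fieldType) (q : F) (s : nat -> F) (la : seq nat) : F :=
  prod_ge1 (fun i => qpoch q (s i ^+ 2) (part la i - part la i.+1)
                     / qpoch q q (part la i - part la i.+1)).

(* (-S)^la *)
Definition negpow (F : fieldType) (s : nat -> F) (la : seq nat) : F :=
  prod_ge1 (fun i => (- s i.-1) ^+ part la i).

(* F_{la/mu}(kappa | Xi, S); L is the auxiliary number of columns used in ZW,
   meant to exceed l(la) and l(mu). *)
Definition onevarF (F : fieldType) (q : F) (xi s rxi rs : nat -> F) (L : nat)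
    (la mu : seq nat) (kappa : F) : F :=
  if (part mu 1%N <= part la 1%N)%N then
    let a := (part la 1%N - part mu 1%N)%N in
    negpow (tau rxi rs) mu / negpow s la
    * (cS q (tau rxi rs) mu / cS q s la)
    * (kappa * s 0%N / xi 0%N) ^+ a
    * (qpoch q (kappa^-1 * s 1%N * xi 1%N) a / qpoch q q a)
    * ZW q xi s rxi rs L a la mu kappa
  else 0.

(* Main.v *)
(* Conservation at the vertices determines the horizontal labels: the only path
   that can contribute to ZW is h_c = la_(c+1) - mu_(c+1).  It consists of
   nonnegative integers satisfying the indicators l <= i exactly when mu and la
   interlace, so ZW is then a single product.  Splitting the weight of column c
   into a part depending on la_(c+1) - mu_(c+1) and the rest, and moving the
   former to index i = c+1, turns both sides into products over i that agree
   factor by factor. *)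

Require Import Defs.
From mathcomp Require Import all_boot all_order all_algebra.
From mathcomp Require Import zify ring.
From mathcomp Require Import classical_sets fsbigop.

Set Implicit Arguments.
Unset Strict Implicit.
Unset Printing Implicit Defensive.

Import Order.TTheory GRing.Theory Num.Theory.
Local Open Scope ring_scope.

Lemma geq_trans : transitive geq.
Proof. by move=> y x z xy yz; exact: leq_trans yz xy. Qed.

(** The entries that are at least [j] form a prefix of a weakly decreasing list. Positivity of [j]
    makes the default entry 0 beyond the end fail the test. *)
Lemma ltn_count_sorted (s : seq nat) (i j : nat) : sorted geq s -> (0 < j)%N ->
  (i < count (leq j) s)%N = (j <= nth 0%N s i)%N.
Proof.
move=> + j0; elim: s i => [|x s IHs] i /= sxs; first by rewrite nth_nil; lia.
have {}IHs := IHs _ (path_sorted sxs).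
have [jx|xj] := leqP j x; first by case: i.
have s0 : count (leq j) s = 0%N.
  apply/eqP; rewrite -leqn0 leqNgt -has_count.
  apply/hasPn => y ys; have /allP/(_ y ys) := order_path_min geq_trans sxs.
  by rewrite /=; lia.
by rewrite s0; case: i => [|i] /=; [lia | rewrite -IHs s0].
Qed.

Lemma count_iota_interval (a b n : nat) : (a <= b)%N -> (b <= n)%N ->
  count (fun j => a < j <= b)%N (iota 1 n) = (b - a)%N.
Proof.
elim: n b => [|n IHn] b ab bn; first by rewrite /=; lia.
rewrite -[n.+1]addn1 iotaD count_cat /=; have [bn'|bn'] := leqP b n.
  by rewrite IHn //; lia.
(* Here [b = n.+1], and the shortened range only sees [j <= n]: induction applies to [minn b n] if
   [a <= n], and otherwise [a = b]. *)
rewrite (eq_in_count (a2 := fun j => a < j <= minn b n)%N); last first.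
  by move=> j; rewrite mem_iota; lia.
have [an|an] := leqP a n; first by rewrite IHn; lia.
rewrite (eq_in_count (a2 := pred0)) ?count_pred0; last first.
  by move=> j; rewrite mem_iota /=; lia.
by lia.
Qed.

Lemma part_nonincr (la : intpart) (i : nat) : (0 < i)%N ->
  (part la i.+1 <= part la i)%N.
Proof.
case: i => // i _; rewrite /part /=; have /andP[sla _] := intpartP la.
have [lei|lti] := leqP (size la) i.+1; first by rewrite nth_default.
exact: (sorted_leq_nth geq_trans leqnn 0%N sla i i.+1 (ltnW lti) lti (leqnSn i)).
Qed.

Lemma part_le_first (la : intpart) (i : nat) : (0 < i)%N ->
  (part la i <= part la 1)%N.
Proof.
elim: i => // -[|i] IHi _; first by [].
exact: leq_trans (part_nonincr _ _) (IHi _).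
Qed.

Lemma part_default (la : seq nat) (i : nat) : (size la < i)%N -> part la i = 0%N.
Proof. by case: i => // i lti; rewrite /part nth_default. Qed.

(** The [j]-th part of the conjugate equals [c] exactly when [part la c.+1 < j <= part la c], so the
    multiplicity counts an interval. *)
Lemma multiplicity_conjugate (la : intpart) (c : nat) : (0 < c)%N ->
  multiplicity c (conjugate la) = (part la c - part la c.+1)%N.
Proof.
move=> c0; rewrite /multiplicity /conjugate count_map.
rewrite -(count_iota_interval (part_nonincr la c0) (part_le_first la c0)).
apply: eq_in_count => j; rewrite mem_iota => /andP[j1 _] /=.
have /andP[sla _] := intpartP la.
have := ltn_count_sorted c.-1 sla j1; have := ltn_count_sorted c sla j1.
by rewrite /part /=; lia.
Qed.

Lemma sumn_part (la : seq nat) (L : nat) : (size la <= L)%N ->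
  sumn la = (\sum_(1 <= i < L.+1) part la i)%N.
Proof.
move=> leL; rewrite big_add1 /= /part sumnE (big_nth 0%N) [RHS](big_cat_nat (n := size la)) //=.
rewrite [X in (_ + X)%N]big_nat_cond [X in (_ + X)%N]big1 ?addn0 // => i.
by move=> /andP[/andP[lei _] _]; rewrite nth_default.
Qed.

Section OneVariable.

Variable F : fieldType.
Implicit Types (q x kappa : F) (f xi s rxi rs : nat -> F).

Lemma prod_ge1E f (L : nat) : (forall i, (L < i)%N -> f i = 1) ->
  prod_ge1 f = \prod_(1 <= i < L.+1) f i.
Proof.
move=> f1; rewrite /prod_ge1 -(@fsbig_widen _ _ _ _ [set` index_iota 1 L.+1]%classic).
- by rewrite -fsbig_seq ?iota_uniq.
- by move=> i /=; rewrite mem_index_iota => /andP[].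
- move=> i [/= i0]; rewrite mem_index_iota => /negP ni.
  by apply: f1; lia.
Qed.

Lemma prod_shiftl (A B : nat -> F) (L : nat) : A L.+1 = 1 ->
  A 1%N * \prod_(1 <= i < L.+1) (A i.+1 * B i) = \prod_(1 <= i < L.+1) (A i * B i).
Proof.
move=> AL; rewrite !big_split /= mulrA; congr (_ * _).
have -> : \prod_(1 <= i < L.+1) A i.+1 = \prod_(2 <= i < L.+2) A i.
  by rewrite [RHS]big_add1.
by rewrite -[LHS](big_ltn (F := A)) // big_nat_recr //= AL mulr1.
Qed.

Lemma qpoch0 q x : qpoch q x 0 = 1.
Proof. by rewrite /qpoch big_geq. Qed.

Lemma qpoch_neq0 q x (n : nat) : (forall m, x * q ^+ m != 1) -> qpoch q x n != 0.
Proof.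
move=> xq; rewrite prodf_seq_neq0; apply/allP => i _ /=.
by rewrite subr_eq0 eq_sym.
Qed.

Lemma W_neq0 q (t2 s2 : F) (i j k l : nat) : W q t2 s2 i j k l != 0 ->
  (i + j = k + l /\ l <= i)%N.
Proof.
rewrite /W; case: (i + j =P k + l)%N => [e|_]; last by rewrite !mul0r eqxx.
by case: (leqP l i) => [|_]; rewrite ?mulr0 ?mul0r ?eqxx.
Qed.

(** Induction on columns: at column [c.+1], conservation gives [h_(c+1) + mu_(c+2) = la_(c+2)],
    hence the value of the label and [mu_(c+2) <= la_(c+2)]; the indicator [l <= i] then becomes
    [la_(c+2) <= mu_(c+1)]. *)
Lemma path_weight_neq0 q xi s rxi rs (L : nat) (la mu : intpart) kappa
    (h : {ffun 'I_L.+1 -> nat}) :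
  (part mu 1 <= part la 1)%N -> h ord0 = (part la 1 - part mu 1)%N ->
  \prod_(1 <= c < L.+1)
      W q (xi c.+1 * s c.+1 / kappa) (tau rxi rs c ^+ 2)
        (multiplicity c (conjugate mu)) (h (inord c.-1))
        (multiplicity c (conjugate la)) (h (inord c)) != 0 ->
  forall c, (c <= L)%N ->
    [/\ (part mu c.+1 <= part la c.+1)%N,
        h (inord c) = (part la c.+1 - part mu c.+1)%N
      & ((0 < c)%N -> (part la c.+1 <= part mu c)%N)].
Proof.
move=> le1 h0; rewrite prodf_seq_neq0 => /allP W0; elim=> [|c IHc] cL.
  by split=> //; rewrite (_ : inord 0 = ord0) //; apply/val_inj; rewrite /= inordK.
have [lec hc _] := IHc (ltnW cL).
have := W0 c.+1; rewrite mem_index_iota => /(_ cL)/W_neq0 /=.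
rewrite hc !multiplicity_conjugate //.
by have := part_nonincr la (ltn0Sn c); have := part_nonincr mu (ltn0Sn c); split; lia.
Qed.

Definition interlacing_path (L : nat) (la mu : seq nat) : {ffun 'I_L.+1 -> nat} :=
  [ffun c => (part la (nat_of_ord c).+1 - part mu (nat_of_ord c).+1)%N].

Lemma ZW_interlace q xi s rxi rs (L : nat) (la mu : intpart) kappa :
  (size la <= L)%N -> interlace mu la ->
  ZW q xi s rxi rs L (part la 1 - part mu 1) la mu kappa =
  \prod_(1 <= c < L.+1)
    W q (xi c.+1 * s c.+1 / kappa) (tau rxi rs c ^+ 2)
      (part mu c - part mu c.+1) (part la c - part mu c)
      (part la c - part la c.+1) (part la c.+1 - part mu c.+1).
Proof.
move=> laL itl; rewrite /ZW -(@fsbig_widen _ _ _ _ [set interlacing_path L la mu]%classic).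
- rewrite fsbig_set1 big_nat_cond [RHS]big_nat_cond.
  apply: eq_bigr => c /andP[/andP[c0 cL] _].
  rewrite !multiplicity_conjugate // !ffunE !inordK ?prednK //.
  by lia.
- move=> _ ->; rewrite /= !ffunE /=; split=> //.
  (* The path ends at 0 because [part la L.+1 = 0]. *)
  by rewrite part_default.
- move=> h [[h0 _] nh] /=; apply/eqP; apply: contra_notT nh => hne.
  have [le1 _] := itl 1%N isT.
  apply/ffunP => c; rewrite ffunE.
  have [_ <- _] := path_weight_neq0 le1 h0 hne (leq_ord c).
  by rewrite inord_val.
Qed.

Lemma ZW_not_interlace q xi s rxi rs (L : nat) (la mu : intpart) kappa :
  (size la < L)%N -> (size mu < L)%N -> (part mu 1 <= part la 1)%N ->
  ~ interlace mu la ->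
  ZW q xi s rxi rs L (part la 1 - part mu 1) la mu kappa = 0.
Proof.
move=> laL muL le1 nitl; apply: fsbig1 => h [h0 _].
apply/eqP; apply: contra_notT nitl => hne [//|i] _.
have Pc := path_weight_neq0 le1 h0 hne.
(* Beyond [L] all parts involved vanish. Otherwise the upper inequality comes from the label [h_i]
   and the lower one from column [i.+1]. *)
have [iL|iL] := leqP i.+1 L; last by rewrite !part_default; lia.
by have [? _ _] := Pc i (ltnW iL); have [_ _ /(_ isT) ?] := Pc i.+1 iL.
Qed.

End OneVariable.

Theorem proposition5p6 (F : fieldType) (q kappa : F) (xi s rxi rs : nat -> F)
    (hrxi : forall i, rxi i ^+ 2 = xi i) (hrs : forall i, rs i ^+ 2 = s i)
    (hkappa : kappa != 0)
    (hxi : forall i, xi i != 0) (hs : forall i, s i != 0)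
    (hq : forall n, (0 < n)%N -> q ^+ n != 1)
    (hs2 : forall i n, s i ^+ 2 * q ^+ n != 1)
    (htau2 : forall i n, tau rxi rs i ^+ 2 * q ^+ n != 1)
    (la mu : intpart) (L : nat)
    (hLla : (size la < L)%N) (hLmu : (size mu < L)%N) :
  (interlace mu la ->
    onevarF q xi s rxi rs L la mu kappa =
    (- kappa) ^ ((sumn la)%:Z - (sumn mu)%:Z)
    * prod_ge1 (fun i =>
        xi i.-1 ^ ((part mu i)%:Z - (part la i)%:Z)
        * ((rs i * rxi i) / (rs i.-1 * rxi i.-1)) ^+ part mu i
        * (qpoch q (kappa^-1 * s i * xi i) (part la i - part mu i)
           * qpoch q (kappa * s i / xi i) (part mu i - part la i.+1)
           * qpoch q q (part la i - part la i.+1)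
           / (qpoch q q (part la i - part mu i)
              * qpoch q q (part mu i - part la i.+1)
              * qpoch q (s i ^+ 2) (part la i - part la i.+1)))))
  /\
  (~ interlace mu la -> onevarF q xi s rxi rs L la mu kappa = 0).
Proof.
split=> [itl|nitl]; rewrite /onevarF; last first.
  by case: ifP => // le1; rewrite ZW_not_interlace // mulr0.
have rs0 i : rs i != 0 by move: (hs i); rewrite -hrs expf_eq0.
have rxi0 i : rxi i != 0 by move: (hxi i); rewrite -hrxi expf_eq0.
have qq0 n : qpoch q q n != 0 by apply: qpoch_neq0 => m; rewrite -exprS hq.
have s20 i n : qpoch q (s i ^+ 2) n != 0 by apply: qpoch_neq0 => m; apply: hs2.
have tau20 i n : qpoch q (tau rxi rs i ^+ 2) n != 0.
  by apply: qpoch_neq0 => m; apply: htau2.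
have tailla i : (L < i)%N -> part la i = 0%N by move=> Li; apply: part_default; lia.
have tailmu i : (L < i)%N -> part mu i = 0%N by move=> Li; apply: part_default; lia.
have le_mula i : (0 < i)%N -> (part mu i <= part la i)%N by move=> /itl[].
have le_lamu i : (0 < i)%N -> (part la i.+1 <= part mu i)%N by move=> /itl[].
rewrite le_mula // ZW_interlace //; last exact: ltnW.
pose A i := (kappa * s i.-1 / xi i.-1) ^+ (part la i - part mu i)
  * (qpoch q (kappa^-1 * s i * xi i) (part la i - part mu i)
     / qpoch q q (part la i - part mu i)).
pose B i := qpoch q (kappa * s i / xi i) (part mu i - part la i.+1)
  / qpoch q (tau rxi rs i ^+ 2) (part mu i - part mu i.+1)
  * (qpoch q q (part mu i - part mu i.+1) / qpoch q q (part mu i - part la i.+1)).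
(* Each vertex weight shares its two pieces between the factors i = c+1 and
   i = c; the missing A 1 is the boundary prefactor. *)
rewrite (eq_big_nat _ _ (F2 := fun c => A c.+1 * B c)); last first.
  move=> c /andP[c0 _]; rewrite /W /A /B.
  have mula1 := le_mula c.+1 isT; have mula := le_mula c c0.
  have lamu := le_lamu c c0; have la1 := part_nonincr la c0.
  rewrite (_ : (_ == _)%N); last by apply/eqP; lia.
  rewrite (_ : (_ <= _)%N); last by lia.
  rewrite (_ : part mu c - part mu c.+1 - _ = part mu c - part la c.+1)%N; last by lia.
  (* The factor [s_(c+1) xi_(c+1)] is common to the square of [tau rxi rs c] and to [t_c^2], and
     cancels. *)
  rewrite (_ : tau rxi rs c ^+ 2 / _ = kappa * s c / xi c); last first.
    rewrite /tau -!hrs -!hrxi; field.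
    by rewrite hkappa !rs0 !rxi0.
  rewrite (_ : xi c.+1 * s c.+1 / kappa = kappa^-1 * s c.+1 * xi c.+1); last by ring.
  by rewrite /=; field; rewrite !qq0 tau20.
rewrite -2!mulrA [X in _ * X]mulrA -[X in _ * (X * _)]/(A 1%N) prod_shiftl; last first.
  by rewrite /A tailla // tailmu // expr0 !qpoch0 divr1 mulr1.
rewrite /negpow /cS !(@prod_ge1E _ _ L);
  [|move=> i Li; have Li1 := leqW Li; rewrite ?(tailla _ Li1, tailmu _ Li1);
    by rewrite ?(tailla _ Li, tailmu _ Li) ?subrr ?expr0z ?expr0 ?qpoch0 ?mulr1 ?divr1 ?mulr1 ..].
(* Interlacing makes every difference of parts nonnegative, so the power of [- kappa] spreads over
   the index [i] with natural exponents. *)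
have -> : (sumn la)%:Z - (sumn mu)%:Z
    = (\sum_(1 <= i < L.+1) (part la i - part mu i))%N%:Z.
  rewrite !(@sumn_part _ L) ?(ltnW hLla) ?(ltnW hLmu) //.
  apply/eqP; rewrite subr_eq -PoszD -big_split /=; apply/eqP; congr Posz.
  by apply: eq_big_nat => i /andP[i0 _]; rewrite subnK ?le_mula.
rewrite -exprnP -prodrXr -!prodf_div -!big_split /=.
apply: eq_big_nat => i /andP[i0 _].
rewrite /A /B; case: i i0 => //= i _.
have [d ->] : exists d, part la i.+1 = (d + part mu i.+1)%N.
  by exists (part la i.+1 - part mu i.+1)%N; rewrite subnK ?le_mula.
rewrite addnK.
set m := part mu i.+1.
have -> : m%:Z - (d + m)%:Z = - d%:Z by rewrite PoszD; ring.
(* The ratio of roots, raised to [m], is the square-root factor of the formula. The powers of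
   [- s i] from the two [negpow] leave exponent [- d], which cancels the [- s i] split off from
   [kappa * s i / xi i] and leaves [(- kappa / xi i) ^+ d]. *)
have -> : - tau rxi rs i = rs i.+1 * rxi i.+1 / (rs i * rxi i) * - s i.
  by rewrite /tau -hrs; field; rewrite rs0 rxi0.
have -> : kappa * s i / xi i = - kappa * - s i / xi i by rewrite mulrNN.
(* This symbol occurs in the numerator of [cS] for [mu] and in the denominator of [B], so it cancels
   as an opaque nonzero [T]. *)
move: (tau20 i.+1 (m - part mu i.+2)%N); move: (qpoch q (tau _ _ _ ^+ 2) _) => T T0.
rewrite -exprnN !exprD !exprMn !exprVn.
field.
by rewrite T0 !qq0 s20 !expf_neq0 ?oppr_eq0 // mulf_neq0.
Qed.
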